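(* For each odd prime $p$, there is a 1-factor $I$ of $K_{2p}$ such that $K_{2p} - I$ has a factorisation into $\mathrm{Cay}(\mathbb{Z}_{2p}; \pm\{1, 2\})$.
   Context: For a group $G$ and a subset $S \subseteq G$ not containing the identity and closed under inverses, the Cayley graph $\mathrm{Cay}(G;S)$ has vertex set $G$, with $g$ adjacent to $g s$ for each $s \in S$. $\pm\{a_1,\dots,a_s\}$ denotes $\{\pm a_1,\dots,\pm a_s\}$. $K_n - I$ is $K_n$ with the edges of a perfect matching $I$ removed. A factorisation of a graph into $H$ is a decomposition of its edge set into edge-disjoint spanning subgraphs each isomorphic to $H$. *)

(* Defs.v *)
(* A graph on a finType V is given by its adjacency relation; as the
   vertex set is the whole type, every subgraph [rel V] is spanning. *)
From HB Require Import structures.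
From mathcomp Require Import all_boot all_order all_fingroup all_algebra.

Set Implicit Arguments.
Unset Strict Implicit.
Unset Printing Implicit Defensive.

Import GRing.Theory.

Definition simple_graph (V : finType) (e : rel V) : Prop :=
  symmetric e /\ irreflexive e.

Definition complete_graph (n : nat) : rel 'I_n := fun x y => x != y.

Definition graph_diff (V : finType) (e f : rel V) : rel V :=
  fun x y => e x y && ~~ f x y.

Definition spanning_subgraph (V : finType) (f e : rel V) : Prop :=
  simple_graph f /\ subrel f e.

Definition graph_iso (V W : finType) (e : rel V) (h : rel W) : Prop :=
  exists2 f : V -> W, bijective f & forall x y, e x y = h (f x) (f y).

Definition one_factor (V : finType) (I e : rel V) : Prop :=
  spanning_subgraph I e /\ forall x, #|[set y | I x y]| = 1.

Definition has_factorisation (V W : finType) (e : rel V) (h : rel W) : Prop :=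
  exists (k : nat) (F : 'I_k -> rel V),
    [/\ forall i, spanning_subgraph (F i) e,
        forall i, graph_iso (F i) h
      & forall x y, e x y -> exists! i, F i x y].

(* Simple only when [cayley_set S] holds, see [cayley_simple]. *)
Definition cayley (gT : finGroupType) (S : {set gT}) : rel gT :=
  fun g h => [exists s in S, h == (g * s)%g].

Definition cayley_set (gT : finGroupType) (S : {set gT}) : Prop :=
  (1%g \notin S) /\ {in S, forall s, (s^-1)%g \in S}.

Definition pm (V : finZmodType) (A : {set V}) : {set V} :=
  A :|: [set (- a)%R | a in A].

Lemma complete_simple n : simple_graph (@complete_graph n).
Proof. by split=> [x y|x]; rewrite /complete_graph ?eqxx // eq_sym. Qed.

Lemma graph_diff_simple (V : finType) (e f : rel V) :
  simple_graph e -> simple_graph f -> simple_graph (graph_diff e f).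
Proof.
by move=> [se ie] [sf _]; split=> [x y|x]; rewrite /graph_diff ?ie // se sf.
Qed.

Lemma cayley_simple (gT : finGroupType) (S : {set gT}) :
  cayley_set S -> simple_graph (cayley S).
Proof.
move=> [S1 SV]; split=> [x y|x].
  by apply/existsP/existsP => -[s /andP[Ss /eqP->]]; exists (s^-1)%g;
    rewrite SV // mulgK eqxx.
apply/negbTE/existsP => -[s /andP[Ss /eqP]].
by rewrite -{1}[x]mulg1 => /mulgI E; rewrite -E (negbTE S1) in Ss.
Qed.

Lemma pmN (V : finZmodType) (A : {set V}) a : a \in pm A -> (- a)%R \in pm A.
Proof.
rewrite !in_setU => /orP[aA|/imsetP[b bA ->]].
  by rewrite (imset_f (fun x => - x)%R aA) orbT.
by rewrite opprK bA.
Qed.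

Lemma pm0 (V : finZmodType) (A : {set V}) : (0 \in pm A)%R = (0 \in A)%R.
Proof.
rewrite in_setU; case: (boolP (0 \in A)%R) => //= A0.
apply/imsetP => -[a aA /esym/eqP]; rewrite oppr_eq0 => /eqP a0.
by rewrite -a0 aA in A0.
Qed.

(* ['Z_n] carries the additive group law, and is Z/n for n > 1 only. *)
Lemma cayley_set_pm12 (n : nat) : 2 < n ->
  cayley_set (pm [set 1%R; 2%:R%R] : {set 'Z_n}).
Proof.
move=> n2; have n1 : 1 < n by apply: ltnW.
split; last by move=> s; exact: pmN.
change ((0 : 'Z_n)%R \notin pm [set 1%R; 2%:R%R]).
rewrite pm0 in_set2 eq_sym oner_eq0 orFb.
by apply/eqP => /(congr1 val); rewrite [RHS](val_Zp_nat n1 2) modn_small.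
Qed.

(* Main.v *)
(* Inside Z_2p the 1-factor joins x to x + p.  Multiplying by an odd residue
   u = 1, 3, ..., p - 2, which is a unit of Z_2p, turns Cay(Z_2p; ±{1, 2})
   into Cay(Z_2p; ±{u, 2u}), and the connection sets ±{u, 2u} partition
   Z_2p \ {0, p}: up to sign, the elements u are the odd residues other than p
   and the elements 2u are the nonzero even residues. *)
Require Import Defs.
From mathcomp Require Import all_boot all_order all_fingroup all_algebra.
From mathcomp Require Import zify.

Set Implicit Arguments.
Unset Strict Implicit.
Unset Printing Implicit Defensive.

Import GRing.Theory.

Lemma mem_pm (V : finZmodType) (A : {set V}) (x : V) :
  (x \in pm A) = (x \in A) || ((- x)%R \in A).
Proof.
rewrite in_setU; congr (_ || _); apply/imsetP/idP => [[a aA ->]|xA].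
  by rewrite opprK.
by exists (- x)%R; rewrite ?opprK.
Qed.

Lemma cayleyE (V : finZmodType) (A : {set V}) (x y : V) :
  cayley A x y = ((y - x)%R \in A).
Proof.
apply/existsP/idP => [[s /andP[sA /eqP->]]|yxA].
  by rewrite FinRing.zmodMgE addrC addKr.
by exists (y - x)%R; rewrite yxA FinRing.zmodMgE addrC subrK eqxx.
Qed.

Lemma Zp_eq_nat (m k : nat) (d : 'Z_m.+2) :
  k < m.+2 -> (d == k%:R)%R = (val d == k).
Proof. by move=> lt_k; rewrite -val_eqE /= val_Zp_nat // modn_small. Qed.

Lemma val_ZpN (m : nat) (d : 'Z_m.+2) :
  val (- d)%R = if val d == 0 then 0 else m.+2 - val d.
Proof.
have := ltn_ord d; rewrite /= /Zp_trunc /= => lt_d.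
case: eqP => [->|/eqP d0]; first by rewrite subn0 modnn.
by rewrite modn_small //; lia.
Qed.

Lemma val_ZpB (m : nat) (x y : 'Z_m.+2) :
  val (y - x)%R = if val (x - y)%R == 0 then 0 else m.+2 - val (x - y)%R.
Proof. by rewrite -opprB val_ZpN. Qed.

(** The residues of u, -u, 2u, -2u modulo n, kept as natural numbers so that covering and
    disjointness become linear arithmetic. *)
Definition step_set (n u : nat) : seq nat :=
  [:: u; n - u; 2 * u; n - 2 * u].

(** Division by the unit u carries ±{u, 2u} onto ±{1, 2}; the bound on 2u makes u and 2u their own
    residues. *)
Lemma mem_step_set (m u : nat) (d : 'Z_m.+2) :
  0 < u -> 2 * u < m.+2 -> coprime m.+2 u ->
  (val d \in step_set m.+2 u) =
    ((u%:R^-1 * d)%R \in pm [set 1%R; 2%:R%R]).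
Proof.
move=> u_gt0 lt_2u co_u.
have Uu : (u%:R : 'Z_m.+2)%R \is a GRing.unit by rewrite unitZpE.
have divE (s e : 'Z_m.+2) : (u%:R^-1 * e == s)%R = (e == u%:R * s)%R.
  by rewrite -(inj_eq (mulrI Uu)) mulVKr.
have lt_d : val d < m.+2 by exact: ltn_ord d.
rewrite mem_pm !in_set2 -mulrN !divE mulr1 -natrM !Zp_eq_nat; try lia.
by rewrite val_ZpN !inE; case: ifP; lia.
Qed.

Lemma step_set_cover (p d : nat) :
  odd p -> d < 2 * p -> d != 0 -> d != p ->
  exists i : 'I_p./2, d \in step_set (2 * p) i.*2.+1.
Proof.
move=> p_odd lt_d d0 dp.
suff [j lt_j dj] : exists2 j, j < p./2 & d \in step_set (2 * p) j.*2.+1.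
  by exists (Ordinal lt_j).
have [d_odd|d_even] := boolP (odd d).
  (* The index is (u - 1)/2, where u is whichever of d and 2p - d lies below p. *)
  have [lt_dp|ge_dp] := ltnP d p.
    by exists d./2; rewrite ?inE; lia.
  by exists (2 * p - d)./2; rewrite ?inE; lia.
(* If d/2 is odd, it serves as u; otherwise u = p - d/2 is odd and d = 2p - 2u. *)
have [e_odd|e_even] := boolP (odd d./2).
  by exists d./2./2; rewrite ?inE; lia.
by exists (p - d./2)./2; rewrite ?inE; lia.
Qed.

(** For odd u < p, the four entries are told apart: u is odd and below p, 2p - u odd and above p, 2u
    is 2 mod 4, and 2p - 2u is 0 mod 4. So d determines its form, hence u. *)
Lemma step_set_inj (p d i j : nat) :
  odd p -> i < p./2 -> j < p./2 ->
  d \in step_set (2 * p) i.*2.+1 -> d \in step_set (2 * p) j.*2.+1 -> i = j.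
Proof. by move=> p_odd lt_i lt_j; rewrite !inE; lia. Qed.

Lemma coprime_2p_odd (p i : nat) :
  prime p -> i < p./2 -> coprime (2 * p) i.*2.+1.
Proof.
move=> p_prime lt_i; rewrite coprimeMl coprime2n /= odd_double /=.
by rewrite prime_coprime // gtnNdvd //; lia.
Qed.

Definition antipodal (m p : nat) : rel 'I_m.+2 :=
  fun x y => val (y - x : 'Z_m.+2)%R == p.

Definition step_graph (m u : nat) : rel 'I_m.+2 :=
  fun x y => val (y - x : 'Z_m.+2)%R \in step_set m.+2 u.

Lemma antipodal_one_factor (m p : nat) : 0 < p -> 2 * p = m.+2 ->
  one_factor (antipodal (m := m) p) (@complete_graph m.+2).
Proof.
move=> p_gt0 E; split; first split; first split.
- move=> x y; rewrite /antipodal (val_ZpB x y).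
  have : val (x - y : 'Z_m.+2)%R < m.+2 by exact: ltn_ord.
  by move: (val (x - y : 'Z_m.+2)%R) => d; case: ifP; lia.
- by move=> x; rewrite /antipodal subrr /=; lia.
- move=> x y; rewrite /antipodal /complete_graph; apply: contraTneq => ->.
  by rewrite subrr /=; lia.
move=> x; rewrite (_ : finset _ = [set (p%:R + x : 'Z_m.+2)%R]) ?cards1 //.
apply/setP=> y; rewrite !inE /antipodal -Zp_eq_nat; last lia.
by rewrite subr_eq.
Qed.

Lemma step_graph_spanning (m p i : nat) :
  odd p -> 2 * p = m.+2 -> i < p./2 ->
  spanning_subgraph (step_graph (m := m) i.*2.+1)
    (graph_diff (@complete_graph m.+2) (antipodal p)).
Proof.
move=> p_odd E lt_i; split; first split.
- move=> x y; rewrite /step_graph (val_ZpB x y) !inE.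
  have : val (x - y : 'Z_m.+2)%R < m.+2 by exact: ltn_ord.
  by move: (val (x - y : 'Z_m.+2)%R) => d; case: ifP; lia.
- by move=> x; rewrite /step_graph subrr /= !inE; lia.
move=> x y; rewrite /step_graph /graph_diff /complete_graph /antipodal !inE.
have [->|_] := eqVneq x y; first by rewrite subrr /=; lia.
(* No step equals p: u < p rules out u and 2p - u, and p is odd while 2u and 2p - 2u are even. *)
lia.
Qed.

Lemma step_graph_iso (m u : nat) :
  0 < u -> 2 * u < m.+2 -> coprime m.+2 u ->
  graph_iso (step_graph (m := m) u)
    (cayley (pm [set 1%R; 2%:R%R] : {set 'Z_m.+2})).
Proof.
move=> u_gt0 lt_2u co_u.
have Uu : (u%:R : 'Z_m.+2)%R \is a GRing.unit by rewrite unitZpE.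
exists (fun x : 'Z_m.+2 => u%:R^-1 * x)%R.
  by exists (fun x : 'Z_m.+2 => u%:R * x)%R => x; rewrite ?mulVKr ?mulKr.
by move=> x y; rewrite cayleyE -mulrBr -mem_step_set.
Qed.

Theorem theorem9 (p : nat) (p_prime : prime p) (p_odd : odd p) :
  exists I : rel 'I_(2 * p),
    one_factor I (@complete_graph (2 * p)) /\
    has_factorisation (graph_diff (@complete_graph (2 * p)) I)
      (cayley (pm [set 1%R; 2%:R%R] : {set 'Z_(2 * p)})).
Proof.
have p_gt0 := prime_gt0 p_prime.
(* In the form [m.+2], the types ['I_m.+2] and ['Z_m.+2] are convertible, so vertices can be
   subtracted. *)
have [m E] : exists m, 2 * p = m.+2 by exists (2 * p - 2); lia.
rewrite E; exists (antipodal p); split; first exact: antipodal_one_factor.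
(* One factor for each of the (p - 1)/2 odd numbers u = 2i + 1 below p. *)
exists p./2, (fun i => step_graph i.*2.+1); split.
- by move=> i; exact: step_graph_spanning.
- move=> i; have lt_i := ltn_ord i.
  by apply: step_graph_iso; [|lia|rewrite -E coprime_2p_odd].
move=> x y /andP[neq_xy np_xy].
have lt_d : val (y - x : 'Z_m.+2)%R < 2 * p by rewrite E; exact: ltn_ord.
have d0 : val (y - x : 'Z_m.+2)%R != 0.
  by rewrite -Zp_eq_nat // subr_eq0 eq_sym.
have [i di] := step_set_cover p_odd lt_d d0 np_xy.
exists i; split=> [|j dj]; first by move: di; rewrite [in step_set _ _]E.
apply/val_inj/(step_set_inj p_odd (ltn_ord i) (ltn_ord j) di).
by rewrite [in step_set _ _]E.
Qed.
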